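(* Let $p\ge2$ be an integer, let $f:E\to\mathbb{R}$ be a continuously differentiable convex function, let $\varphi:Q\to\mathbb{R}$ be a lower semicontinuous convex function on a closed convex set $Q\subseteq E$ that is $\sigma$-strongly convex of order $p$ ($\sigma>0$), and let $x^*$ be a minimizer of $f$ over $Q$. Let $s>0$, $M>0$, $C>0$. Let $z_0\in E^*$, $x_0=\nabla\varphi^*(z_0)$, $y_0\in Q$, and let $\{x_k\},\{y_k\},\{z_k\}$ be sequences with $y_k\in Q$ satisfying, for all $k\ge0$, $$x_{k+1}=\frac{p}{k+p}\nabla\varphi^*(z_k)+\frac{k}{k+p}y_k,\qquad z_{k+1}=z_k-Csp(k+1)^{(p-1)}\nabla f(y_{k+1}),$$ and, for all $k\ge1$, $$\langle\nabla f(y_k),x_k-y_k\rangle\ge Ms^{\frac{1}{p-1}}\|\nabla f(y_k)\|_*^{\frac{p}{p-1}}.$$ If $0<C\le\dfrac{\sigma M^{p-1}}{(p-1)^{p-1}p}$, then for all $k\ge1$ $$f(y_k)-f(x^* )\le\frac{D_\varphi(x^*,x_0)}{Csk^{(p)}},$$ where $D_\varphi(x^*,x_0)=\varphi(x^* )-\varphi(x_0)-\langle z_0,x^*-x_0\rangle$. In addition, if $0<C<\dfrac{\sigma M^{p-1}}{(p-1)^{p-1}p}$, then, as $k\to\infty$, $$\min_{0\le i\le k}\|\nabla f(y_i)\|_*^{\frac{p}{p-1}}=o\left(\frac{1}{k^{p+1}}\right).$$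
   Context: $E$ is a finite-dimensional real vector space with norm $\|\cdot\|$, $E^*$ its dual with dual norm $\|\cdot\|_*$, and $\langle s,x\rangle$ denotes the value of $s\in E^*$ at $x\in E$. For an integer $m\ge1$, $k^{(m)}=k(k+1)\cdots(k+m-1)$ is the rising factorial. $\varphi$ is extended by $+\infty$ outside $Q$ (lower semicontinuity and the subdifferential refer to this extension). $\varphi$ is $\sigma$-strongly convex of order $p$ if $\varphi(y)-\varphi(x)-\langle g,y-x\rangle\ge\frac{\sigma}{p}\|y-x\|^p$ for all $x,y\in Q$ and $g\in\partial\varphi(x)$. The conjugate is $\varphi^*(s)=\sup_{x\in E}\{\langle s,x\rangle-\varphi(x)\}$, which under this assumption is finite and differentiable on $E^*$, with $\nabla\varphi^*$ taking values in $Q$. A minimizer $x^*$ of $f$ over $Q$ is assumed to exist. *)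

(* Defs.v *)
From HB Require Import structures.
From mathcomp Require Import all_boot all_order all_algebra.
From mathcomp Require Import all_classical all_reals all_analysis.

Set Implicit Arguments.
Unset Strict Implicit.
Unset Printing Implicit Defensive.
Import Order.TTheory GRing.Theory Num.Theory.
Import numFieldNormedType.Exports.

Local Open Scope classical_set_scope.
Local Open Scope ring_scope.

#[short(type="finDimNormedModType")]
HB.structure Definition FinDimNormedModule (R : numFieldType) :=
  {E of Vector R E & NormedModule R E}.

Definition rising (k m : nat) : nat := (\prod_(i < m) (k + i))%N.

Section Definitions.
Context {R : realType} {E : finDimNormedModType R}.

Definition dual_norm (s : 'Hom(E, R^o)) : R :=
  sup [set (s x : R) | x in [set x : E | `|x| <= 1]].

(* The differential as an element of the dual; it is the gradient wherever f *)
(* is differentiable.                                                        *)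
Definition grad (f : E -> R^o) (x : E) : 'Hom(E, R^o) := linfun ('d f x).

Definition continuously_differentiable (f : E -> R^o) : Prop :=
  (forall x, differentiable f x) /\
  forall x (e : R), 0 < e -> \forall y \near x, dual_norm (grad f y - grad f x) < e.

(* A function on Q is represented by a function on E; only its values on Q   *)
(* matter, since every notion below goes through its extension by +oo.       *)
Definition ext (Q : set E) (phi : E -> R) : E -> \bar R :=
  patch (fun=> +oo%E) Q (EFin \o phi).

Definition subdifferential (h : E -> \bar R) (x : E) : set 'Hom(E, R^o) :=
  [set g | forall y, (h x + (g (y - x))%:E <= h y)%E].

Definition strongly_convex (Q : set E) (phi : E -> R) (p : nat) (sigma : R) :
    Prop :=
  forall x y, Q x -> Q y ->
  forall g, subdifferential (ext Q phi) x g ->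
    sigma / p%:R * `|y - x| ^+ p <= phi y - phi x - g (y - x).

Definition conjugate (h : E -> \bar R) (s : 'Hom(E, R^o)) : \bar R :=
  ereal_sup [set ((s x)%:E - h x)%E | x in [set: E]].

(* Frechet differentiability on the dual, the bidual being identified with   *)
(* E: the derivative of h at s is t |-> t v.                                 *)
Definition is_dual_grad (h : 'Hom(E, R^o) -> R) (s : 'Hom(E, R^o)) (v : E) :
    Prop :=
  forall e : R, 0 < e -> exists2 d : R, 0 < d &
    forall t, dual_norm (t - s) < d ->
      `|h t - h s - (t - s) v| <= e * dual_norm (t - s).

(* Arbitrary where h is not differentiable. *)
Definition dual_grad (h : 'Hom(E, R^o) -> R) (s : 'Hom(E, R^o)) : E :=
  get (is_dual_grad h s).

(* The gradient of phi^*; [fine] is harmless because phi^* is finite         *)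
(* everywhere when phi is convex, lower semicontinuous and strongly convex   *)
(* on a nonempty closed convex set.                                          *)
Definition grad_conjugate (Q : set E) (phi : E -> R) : 'Hom(E, R^o) -> E :=
  dual_grad (fine \o conjugate (ext Q phi)).

End Definitions.

(* Main.v *)
Require Import Defs.
From HB Require Import structures.
From mathcomp Require Import all_boot all_order all_algebra.
From mathcomp Require Import all_classical all_reals all_analysis.
From mathcomp Require Import ring lra zify.

Set Implicit Arguments.
Unset Strict Implicit.
Unset Printing Implicit Defensive.
Import Order.TTheory GRing.Theory Num.Theory.
Import numFieldNormedType.Exports.
Import VectorInternalTheory.

Local Open Scope classical_set_scope.
Local Open Scope ring_scope.

(* Write v_k for the gradient of phi^* at z_k: it is the unique v in Q with
   z_k a subgradient of phi at v. The Lyapunov function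
     E_k = C s k^(p) (f(y_k) - f(xstar)) + D_phi(xstar, v_k)
   starts at D_phi(xstar, x_0). Strong convexity of phi and convexity of f give
     E_{k+1} - E_k <= a |g| d - (sigma/p) d^p
                      - C s (k+1)^(p) M s^(1/(p-1)) |g|^(p/(p-1))
   with |g| the dual norm of the gradient of f at y_{k+1}, d = |v_{k+1} - v_k| and
   a = C s p (k+1)^(p-1). By Young's inequality the last term absorbs the first
   two under the bound on C, so E_k is nonincreasing. Under the strict bound a
   fixed fraction of the last term survives, so the differences
   E_{k/2} - E_k, which tend to 0, dominate a multiple of k^(p+1) times the
   minimum. *)

(** * Minima of lower semicontinuous functions on compact sets *)

Lemma lsc_attains_min (R : realType) (T : topologicalType) (A : set T)
    (h : T -> R) :
  compact A -> A !=set0 ->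
  (forall x a, A x -> a < h x -> \forall y \near x, A y -> a < h y) ->
  exists2 c, A c & forall y, A y -> h c <= h y.
Proof.
move=> /compact_near_coveringP cA [x0 Ax0] lsc; apply: contrapT => nomin.
have below x : A x -> exists2 y, A y & h y < h x.
  move=> Ax; apply: contrapT => nb; apply: nomin; exists x => // y Ay.
  by rewrite leNgt; apply/negP => yx; apply: nb; exists y.
(* The sets containing a sublevel set of [h] in [A] form a filter. Without a minimizer,
   near-covering compactness yields a point [y0] of [A] whose value lies below every value on [A],
   including its own. *)
pose F : set_system T :=
  [set B | exists2 y0, A y0 & forall y, A y -> h y <= h y0 -> B y].
have FF : Filter F.
  split; first by exists x0.
  - move=> B1 B2 [y1 A1 H1] [y2 A2 H2].
    have [le12|/ltW le21] := leP (h y1) (h y2).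
      exists y1 => // y Ay yy; split; [exact: H1|apply: H2 => //; lra].
    exists y2 => // y Ay yy; split; [apply: H1 => //; lra|exact: H2].
  - by move=> B1 B2 B12 [y1 A1 H1]; exists y1 => // y Ay /(H1 y Ay)/B12.
have [|y0 Ay0 /(_ _ Ay0 (lexx _)) /(_ _ Ay0)/(_ Ay0)] :=
  cA T F (fun i x => A x -> h i < h x) FF; last by rewrite ltxx.
move=> x Ax; have [y Ay yx] := below x Ax.
exists ([set x' | A x' -> h y < h x'], [set i | A i /\ h i <= h y]).
  by split; [exact: lsc|exists y].
by move=> [x' i] /= [H [Ai iy]] Ax'; apply: le_lt_trans iy (H Ax').
Qed.

(** * Coordinates, compactness and the dual of a finite-dimensional space *)

Lemma rV_linear_bounded (R : realType) n (V : normedModType R)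
    (g : {linear 'rV[R]_n -> V}) :
  exists2 K : R, 0 <= K & forall w, `|g w| <= K * `|w|.
Proof.
exists (\sum_i `|g (delta_mx 0 i)|); first exact: sumr_ge0.
move=> w; rewrite {1}(row_sum_delta w) linear_sum (le_trans (ler_norm_sum _ _ _))//.
rewrite mulr_suml; apply: ler_sum => i _; rewrite linearZ/= normrZ mulrC.
apply: ler_wpM2l => //.
rewrite [leRHS]/Num.norm /= mx_normrE.
by apply/bigmax_geP; right => /=; exists (0, i).
Qed.

Section finite_dimension.
Context {R : realType} {E : finDimNormedModType R}.

Lemma r2v_continuous : continuous (r2v : 'rV[R]_(dim E) -> E).
Proof.
apply: bounded_linear_continuous; apply/linear_boundedP.
have [K K0 HK] := rV_linear_bounded (r2v : {linear 'rV[R]_(dim E) -> E}).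
exists K; split; first exact: ger0_real.
by move=> r Kr x; rewrite (le_trans (HK x))// ler_wpM2r// ltW.
Qed.

(** On the compact unit sphere of coordinate vectors the norm of [r2v w] attains a minimum, positive
    because [r2v] is injective; by homogeneity its inverse is a valid constant. *)
Lemma v2r_bounded : exists2 c : R, 0 < c & forall x : E, `|v2r x| <= c * `|x|.
Proof.
pose S : set 'rV[R]_(dim E) := [set w : 'rV[R]_(dim E) | `|w| = 1].
have Sn (w : 'rV[R]_(dim E)) : w != 0 -> S (`|w|^-1 *: w).
  move=> w0; rewrite /S/= normrZ normfV normr_id mulVf//.
  by rewrite normr_eq0.
have cS : compact S.
  apply: bounded_closed_compact.
    exists 1; split; first exact: real1.
    by move=> r r1 w /= ->; exact: ltW.
  rewrite (_ : S = (fun w => `|w|) @^-1` [set 1])//.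
  apply: closed_comp; first by move=> w _; exact: norm_continuous.
  exact: closed_eq.
(* An empty coordinate sphere means dimension zero, where all coordinate vectors vanish and the
   constant 1 serves. *)
have [[w1 Sw1]|S0] := pselect (S !=set0); last first.
  exists 1 => // x; have [->|x0] := eqVneq (v2r x) 0.
    by rewrite normr0 mul1r.
  by exfalso; apply: S0; exists (`|v2r x|^-1 *: v2r x); exact: Sn.
have [] := @compact_EVT_min 'rV[R]_(dim E) R (fun w => `|r2v w : E|) S _ cS.
- by exists w1.
- apply: continuous_subspaceT => w; apply: continuous_comp.
    exact: r2v_continuous.
  exact: norm_continuous.
move=> w0 /set_mem Sw0 wmin.
have m0 : 0 < `|r2v w0 : E|.
  rewrite normr_gt0; apply/eqP => r0.
  have : w0 = 0 by apply: (@r2v_inj _ E); rewrite r0 linear0.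
  by move=> w00; move: Sw0; rewrite /S/= w00 normr0 => /esym/eqP; rewrite oner_eq0.
exists `|r2v w0 : E|^-1; first by rewrite invr_gt0.
move=> x; have [->|x0] := eqVneq (v2r x) 0.
  by rewrite normr0 mulr_ge0// invr_ge0.
have := wmin _ (mem_set (Sn _ x0)).
rewrite linearZ/= v2rK normrZ normfV normr_id.
rewrite [X in _ <= X]mulrC ler_pdivlMr ?normr_gt0// => ?.
by rewrite [leRHS]mulrC ler_pdivlMr// mulrC.
Qed.

Lemma bounded_closed_compact_findim (A : set E) (b : R) :
  (forall x, A x -> `|x| <= b) -> closed A -> compact A.
Proof.
move=> Ab Acl; have [c c0 Hc] := v2r_bounded.
pose B := (r2v : 'rV[R]_(dim E) -> E) @^-1` A.
have -> : A = (r2v : 'rV[R]_(dim E) -> E) @` B.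
  apply/seteqP; split => [x Ax|x [w Bw <-]//].
  by exists (v2r x); rewrite /B /= v2rK.
apply: continuous_compact.
  exact/continuous_subspaceT/r2v_continuous.
apply: bounded_closed_compact; last first.
  by apply: closed_comp => // w _; exact: r2v_continuous.
exists (c * b); split; first exact: num_real.
move=> r rb w Bw; apply: le_trans (ltW rb).
rewrite -[w](@r2vK _ E) (le_trans (Hc _))// ler_pM2l//.
exact: Ab.
Qed.

Implicit Types (s t : 'Hom(E, R^o)).

Lemma functional_bounded s :
  exists2 K : R, 0 <= K & forall x, `|s x : R| <= K * `|x|.
Proof.
have [c c0 Hc] := v2r_bounded.
have [K K0 HK] := rV_linear_bounded (s \o r2v : {linear 'rV[R]_(dim E) -> R^o}).
exists (K * c); first by rewrite mulr_ge0// ltW.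
move=> x; rewrite -{1}[x]v2rK (le_trans (HK _))// -mulrA ler_wpM2l//.
Qed.

Lemma dual_norm_has_sup s :
  has_sup [set (s x : R) | x in [set x : E | `|x| <= 1]].
Proof.
have [K K0 HK] := functional_bounded s.
split; first by exists (s 0); exists 0 => //=; rewrite normr0.
exists K => _ [x /= x1 <-]; rewrite (le_trans (ler_norm _))//.
by rewrite (le_trans (HK x))// -[leRHS]mulr1 ler_wpM2l.
Qed.

Lemma dual_norm_ge0 s : 0 <= dual_norm s.
Proof.
apply: ub_le_sup; first by have [] := dual_norm_has_sup s.
by exists 0 => /=; rewrite ?normr0 ?linear0.
Qed.

Lemma le_dual_norm s x : s x <= dual_norm s * `|x|.
Proof.
have [->|x0] := eqVneq x 0; first by rewrite linear0 normr0 mulr0.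
have nx : 0 < `|x| by rewrite normr_gt0.
rewrite -ler_pdivrMr//.
apply: ub_le_sup; first by have [] := dual_norm_has_sup s.
exists (`|x|^-1 *: x) => /=.
  by rewrite normrZ normfV normr_id mulVf// gt_eqF.
by rewrite linearZ/= mulrC.
Qed.

Lemma dual_normZ_le (a : R) s : 0 <= a -> dual_norm (a *: s) <= a * dual_norm s.
Proof.
move=> a0; apply: ge_sup; first by have [] := dual_norm_has_sup (a *: s).
move=> _ [x /= x1 <-]; rewrite lfunE/= ler_wpM2l//.
rewrite (le_trans (le_dual_norm _ _))// -[leRHS]mulr1 ler_wpM2l//.
exact: dual_norm_ge0.
Qed.

Lemma functionals_separate (u : E) : (forall s, s u = 0) -> u = 0.
Proof.
move=> su; apply: v2r_inj; rewrite linear0; apply/rowP => i; rewrite mxE.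
pose g (x : E) : R^o := v2r x 0 i.
have gl : linear g by move=> a x y; rewrite /g linearP !mxE.
pose gL := GRing.isLinear.Build _ _ _ _ g gl.
pose G : {linear E -> R^o} := HB.pack g gL.
by have := su (linfun G); rewrite lfunE.
Qed.

Lemma functional_continuous s : continuous (s : E -> R^o).
Proof.
apply: bounded_linear_continuous; apply/linear_boundedP.
have [K K0 HK] := functional_bounded s.
exists K; split; first exact: ger0_real.
by move=> r Kr x; rewrite (le_trans (HK x))// ler_wpM2r// ltW.
Qed.

(** [dual_grad] is a choice made by [get], so uniqueness is what identifies its value. The two
    expansions are compared along [s + a *: r] with small [a], and functionals separate points. *)
Lemma dual_grad_unique (h : 'Hom(E, R^o) -> R) s u v :
  is_dual_grad h s u -> is_dual_grad h s v -> u = v.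
Proof.
move=> hu hv; apply/eqP; rewrite -subr_eq0; apply/eqP.
apply: functionals_separate => r.
have D0 := dual_norm_ge0 r.
suff le_e e : 0 < e -> `|r (u - v) : R| <= 2 * e * dual_norm r.
  have [D0'|] := eqVneq (dual_norm r) 0.
    by have := le_e _ (@ltr01 R); rewrite D0' mulr0 normr_le0 => /eqP.
  move=> Dn0; have {Dn0}Dp : 0 < dual_norm r by rewrite lt_def Dn0.
  apply/eqP; rewrite -normr_le0; apply/ler_addgt0Pr => e e0; rewrite add0r.
  have := le_e (e / (2 * dual_norm r)); rewrite divr_gt0 ?mulr_gt0// => /(_ isT).
  by congr (_ <= _); field; rewrite gt_eqF.
move=> e0; have [d1 d10 H1] := hu e e0; have [d2 d20 H2] := hv e e0.
pose d := Num.min d1 d2.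
have d0 : 0 < d by rewrite lt_min d10.
(* The [+ 1] keeps the denominator positive when [dual_norm r] is zero. *)
pose a := d / (dual_norm r + 1).
have a0 : 0 < a by rewrite divr_gt0// ltr_wpDl.
have an : dual_norm (a *: r) < d.
  rewrite (le_lt_trans (dual_normZ_le _ (ltW a0)))//.
  by rewrite /a mulrAC ltr_pdivrMr ?ltr_wpDl// ltr_pM2l// ltrDl.
have st : (s + a *: r) - s = a *: r by rewrite addrC addKr.
have := H1 (s + a *: r); have := H2 (s + a *: r); rewrite st.
move: an; rewrite lt_min => /andP[an1 an2] /(_ an2) h2 /(_ an1) h1.
have N := ler_wpM2l (ltW e0) (dual_normZ_le r (ltW a0)).
rewrite -(ler_pM2l a0) -{1}(gtr0_norm a0) -normrM.
have -> : a * r (u - v) = (h (s + a *: r) - h s - (a *: r) v)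
    - (h (s + a *: r) - h s - (a *: r) u) :> R.
  by rewrite !lfunE/= linearB /GRing.scale/=; ring.
rewrite (le_trans (ler_normB _ _))// (le_trans (lerD h2 h1))//; lra.
Qed.

End finite_dimension.

(** * Convexity along segments *)

Section convex.
Context {R : realType} {E : lmodType R}.

Lemma convex_function_line (A : set E) (h : E -> R) (u w : E) (t : R) :
  convex_function A h -> A u -> A w -> 0 <= t -> t <= 1 ->
  h (u + t *: (w - u)) <= h u + t * (h w - h u).
Proof.
move=> ch Au Aw t0 t1.
have := ch (Itv01 t0 t1) w u (mem_set Aw) (mem_set Au).
have -> : (conv (Itv01 t0 t1) (w : convex_lmodType E) u) = u + t *: (w - u).
  by rewrite /conv/= scalerBl scale1r scalerBr addrCA.
rewrite convRE/= /unstable.onem => /le_trans; apply; lra.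
Qed.

Lemma convex_set_line (A : set E) (u w : E) (t : R) :
  convex_set A -> A u -> A w -> 0 <= t -> t <= 1 -> A (u + t *: (w - u)).
Proof.
move=> cA Au Aw t0 t1.
have := cA w u (Itv01 t0 t1) (mem_set Aw) (mem_set Au).
have -> : (conv (Itv01 t0 t1) (w : convex_lmodType E) u) = u + t *: (w - u).
  by rewrite /conv/= scalerBl scale1r scalerBr addrCA.
by move/set_mem.
Qed.

(** The limit of [t] to 0, carried out with a single small [t]; it turns minimality along a segment
    into a first-order condition. *)
Lemma ge0_of_affine_ge0 (a b : R) :
  (forall t, 0 < t -> t <= 1 -> 0 <= a + t * b) -> 0 <= a.
Proof.
move=> H; rewrite leNgt; apply/negP => a0.
have d0 : 0 < `|b| - a by rewrite subr_gt0 (lt_le_trans a0).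
(* For negative [a] this [t] lies in (0, 1] and makes [a + t * b] negative, because 2(|b| - a)
   exceeds b. *)
have := H (- a / (2 * (`|b| - a))).
rewrite divr_gt0 ?oppr_gt0 ?mulr_gt0// => /(_ isT).
rewrite ler_pdivrMr ?mulr_gt0//.
have bn := normr_ge0 b; have bl := ler_norm b.
have -> : - a <= 1 * (2 * (`|b| - a)) by lra.
move=> /(_ isT).
have -> : a + - a / (2 * (`|b| - a)) * b =
   a * (2 * (`|b| - a) - b) / (2 * (`|b| - a)) by field; rewrite gt_eqF.
rewrite pmulr_lge0 ?invr_gt0 ?mulr_gt0// nmulr_rge0//; lra.
Qed.

End convex.

(** Beyond d = 1 + L one has d^p >= d^2 >= L d; up to that point the left side is nonpositive.
    Coercivity of strongly convex functions rests on this. *)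
Lemma expr_superlinear (R : realDomainType) (p : nat) (L d : R) : (2 <= p)%N ->
  0 <= L -> 0 <= d -> L * d - L * (1 + L) <= d ^+ p.
Proof.
move=> p2 L0 d0; have dp0 : 0 <= d ^+ p by rewrite exprn_ge0.
have [dL|dL] := leP d (1 + L); first by have := ler_wpM2l L0 dL; lra.
have d1 : 1 <= d by lra.
have : d ^+ 2 <= d ^+ p by rewrite ler_weXn2l.
rewrite expr2 => h.
have hL : L * d <= d * d by rewrite ler_wpM2r//; lra.
have hLL : 0 <= L * (1 + L) by rewrite mulr_ge0// addr_ge0.
lra.
Qed.

(** * Coercive minimization and existence of a subgradient *)

Section conjugate.
Context {R : realType} {E : finDimNormedModType R}.
Variables (Q : set E) (phi : E -> R).
Implicit Types s g : 'Hom(E, R^o).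

Lemma ext_in x : Q x -> ext Q phi x = (phi x)%:E.
Proof. by move=> Qx; rewrite /ext /patch mem_set. Qed.

Lemma ext_out x : ~ Q x -> ext Q phi x = +oo%E.
Proof. by move=> Qx; rewrite /ext /patch memNset. Qed.

Lemma subdifferential_extP x g : Q x ->
  subdifferential (ext Q phi) x g <->
  forall y, Q y -> phi x + g (y - x) <= phi y.
Proof.
move=> Qx; rewrite /subdifferential /=; split => H y.
  by move=> Qy; have := H y; rewrite !ext_in.
rewrite ext_in//; have [Qy|Qy] := pselect (Q y).
  by rewrite ext_in// lee_fin; exact: H.
by rewrite ext_out// leey.
Qed.

Hypothesis Qcl : closed Q.
Hypothesis Qcvx : convex_set Q.
Hypothesis philsc : lower_semicontinuous (ext Q phi).
Hypothesis phicvx : convex_function Q phi.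

Lemma lsc_addition (l : E -> R^o) x a : continuous l -> Q x ->
  a < phi x + l x -> \forall y \near x, Q y -> a < phi y + l y.
Proof.
move=> cl Qx axl.
pose e := (phi x + l x - a) / 2.
have e0 : 0 < e by rewrite divr_gt0// subr_gt0.
have [|V nV HV] := philsc (x := x) (a := phi x - e).
  by rewrite ext_in// lte_fin gtrBl.
have nl : \forall y \near x, `|l x - l y| < e.
  by move/cvgrPdist_lt : (cl x); exact.
near=> y => Qy.
have Vy : V y by near: y.
have := HV y Vy; rewrite ext_in// lte_fin => h1.
have : `|l x - l y| < e by near: y.
rewrite ltr_norml => /andP[h2 h3].
by move: h1 h2 h3; rewrite /e; lra.
Unshelve. all: by end_near.
Qed.

Lemma coercive_attains_min (l : E -> R^o) (k : R) : continuous l -> Q !=set0 ->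
  (forall x, Q x -> k + `|x| <= phi x + l x) ->
  exists2 v, Q v & forall x, Q x -> phi v + l v <= phi x + l x.
Proof.
move=> cl [x1 Qx1] co.
(* By coercivity, points of [Q] of norm above [b] have a larger value than [x1], so minimizing over
   the ball of radius [b] suffices. *)
pose b := phi x1 + l x1 - k.
pose B := Q `&` [set x : E | `|x| <= b].
have cB : compact B.
  apply: (@bounded_closed_compact_findim _ _ _ b) => [x []//|].
  apply: closedI => //.
  rewrite (_ : [set x | _] = (fun x : E => `|x|) @^-1` [set r | r <= b])//.
  by apply: closed_comp; [move=> w _; exact: norm_continuous|exact: closed_le].
have Bx1 : B x1 by split => //=; rewrite /b lerBrDl co.
have [||v [Qv vb] vmin] := @lsc_attains_min R E B (fun x => phi x + l x) cB.
- by exists x1.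
- move=> x a [Qx _] /(lsc_addition cl Qx).
  by apply: filterS => y H [Qy _]; exact: H.
exists v => // x Qx; have [xb|xb] := leP `|x| b; first exact: vmin.
by apply: le_trans (vmin _ Bx1) _; move: (co x Qx) xb; rewrite /b; lra.
Qed.

(** For [x] outside the unit ball around [x1], the point of the segment at distance 1 from [x1] has
    value at least the minimum [phi v] over that ball; convexity extrapolates this to a drop at most
    linear in the distance. *)
Lemma convex_lower_bound : Q !=set0 ->
  exists m L : R, 0 <= L /\ forall x, Q x -> m - L * `|x| <= phi x.
Proof.
move=> [x1 Qx1].
pose B := Q `&` [set x : E | `|x - x1| <= 1].
have cB : compact B.
  apply: (@bounded_closed_compact_findim _ _ _ (1 + `|x1|)) => [x [_ /= x11]|].
    by rewrite -[x](subrK x1) (le_trans (ler_normD _ _))// lerD2r.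
  apply: closedI => //.
  rewrite (_ : [set x | _] = (fun x : E => `|x - x1|) @^-1` [set r | r <= 1])//.
  apply: closed_comp; [move=> w _|exact: closed_le].
  by apply: cvg_norm; apply: cvgB; [exact: cvg_id|exact: cvg_cst].
have [||v [Qv vb] vmin] := @lsc_attains_min R E B phi cB.
- by exists x1; split => //=; rewrite subrr normr0.
- move=> x a [Qx _] ax.
  have c0 : continuous (cst 0 : E -> R^o) by move=> ?; exact: cvg_cst.
  have := @lsc_addition (cst 0) x a c0 Qx.
  rewrite /= addr0 => /(_ ax); apply: filterS => y H [Qy _].
  by have := H Qy; rewrite addr0.
have vx1 : phi v <= phi x1 by apply: vmin; split => //=; rewrite subrr normr0.
exists (phi x1 - (phi x1 - phi v) * (1 + `|x1|)), (phi x1 - phi v).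
rewrite subr_ge0; split => // x Qx.
have D0 : 0 <= phi x1 - phi v by rewrite subr_ge0.
have dx : `|x - x1| <= `|x| + `|x1| := ler_normB _ _.
suff h : (phi x1 - phi v) * (1 + `|x - x1|) >= phi x1 - phi x.
  by have := ler_wpM2l D0 dx; lra.
have [d1|d1] := leP `|x - x1| 1.
  have : phi v <= phi x by apply: vmin.
  by have := mulr_ge0 D0 (normr_ge0 (x - x1)); lra.
have d0 : 0 < `|x - x1| by lra.
have i0 : 0 <= `|x - x1|^-1 by rewrite invr_ge0.
have i1 : `|x - x1|^-1 <= 1 by rewrite invf_le1// ltW.
have : phi v <= phi (x1 + `|x - x1|^-1 *: (x - x1)).
  apply: vmin; split => /=; first exact: convex_set_line.
  by rewrite addrC addKr normrZ normfV normr_id mulVf// gt_eqF.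
move=> /le_trans /(_ (convex_function_line phicvx Qx1 Qx i0 i1)).
rewrite -lerBlDl ler_pdivlMl//; lra.
Qed.

(* Adding a Euclidean square makes phi coercive, and the optimality condition
   at a minimizer of the sum exhibits a subgradient of phi: this replaces the
   Hahn-Banach theorem. *)
Lemma subdifferential_nonempty : Q !=set0 ->
  exists u g, Q u /\ subdifferential (ext Q phi) u g.
Proof.
move=> Q0; have [m [L [L0 HL]]] := convex_lower_bound Q0.
(* [B] is the Euclidean inner product of coordinates, [q] its quadratic form, [e] the coordinate
   basis of [E]. *)
pose B (a b : E) : R := \sum_i v2r a 0 i * v2r b 0 i.
pose q (a : E) : R^o := B a a.
pose e i : E := r2v (delta_mx 0 i).
have B_lin a : linear (B a : E -> R^o).
  move=> c b b'; rewrite /B scaler_sumr -big_split/=.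
  by apply: eq_bigr => i _; rewrite linearP !mxE /GRing.scale/=; ring.
have BC a b : B a b = B b a by apply: eq_bigr => i _; rewrite mulrC.
have coord_cont i : continuous ((fun a => v2r a 0 i) : E -> R^o).
  have gl : linear ((fun a => v2r a 0 i) : E -> R^o).
    by move=> c a b; rewrite linearP !mxE.
  pose G : {linear E -> R^o} :=
    HB.pack ((fun a => v2r a 0 i) : E -> R^o) (GRing.isLinear.Build _ _ _ _ _ gl).
  rewrite (_ : (fun _ => _) = linfun G); first exact: functional_continuous.
  by apply/funext => a; rewrite lfunE.
have q_cont : continuous q.
  move=> a; apply: cvg_big => [|i _]; first exact: add_continuous.
  by apply: cvgM; exact: coord_cont.
have q_lb (K : R) a : 0 <= K -> 2 * K * `|a| - \sum_i (K * `|e i|) ^+ 2 <= q a.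
  move=> K0; have : `|a| <= \sum_i `|v2r a 0 i| * `|e i|.
    rewrite -{1}[a]v2rK {1}(row_sum_delta (v2r a)) linear_sum.
    rewrite (le_trans (ler_norm_sum _ _ _))//.
    by apply: ler_sum => i _; rewrite linearZ/= normrZ.
  move=> /(ler_wpM2l (mulr_ge0 (ler0n _ 2) K0)) /le_trans h.
  rewrite lerBlDr; apply: h.
  rewrite mulr_sumr -big_split/=; apply: ler_sum => i _.
  have := sqr_ge0 (`|v2r a 0 i| - K * `|e i|).
  have := real_normK (num_real (v2r a 0 i)); rewrite !expr2; nra.
(* With [K = (L + 1) / 2], [q] grows at slope [L + 1], which offsets the slope [L] lost by [phi] and
   leaves slope 1 for coercivity. *)
have [|u Qu umin] := @coercive_attains_min q
    (m - \sum_i ((L + 1) / 2 * `|e i|) ^+ 2) q_cont Q0.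
  move=> x Qx; have := HL x Qx; have := q_lb ((L + 1) / 2) x;
  have -> : 0 <= (L + 1) / 2 by lra.
  by move=> /(_ isT); lra.
pose G : {linear E -> R^o} :=
  HB.pack (B u : E -> R^o) (GRing.isLinear.Build _ _ _ _ _ (B_lin u)).
(* The subgradient is minus the derivative of [q] at the minimizer [u] of [phi + q]; expanding [q]
   along a segment and letting [t] tend to 0 verifies it. *)
exists u, (linfun ((- 2 : R) \*: G)); split => //.
apply/subdifferential_extP => // y Qy; rewrite lfunE/=.
rewrite -subr_ge0; apply: (@ge0_of_affine_ge0 _ _ (q (y - u))) => t t0 t1.
have := umin _ (convex_set_line Qcvx Qu Qy (ltW t0) t1).
have := convex_function_line phicvx Qu Qy (ltW t0) t1.
have -> : q (u + t *: (y - u)) = q u + 2 * t * B u (y - u) + t ^+ 2 * q (y - u).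
  rewrite /q addrC [LHS]B_lin BC B_lin [B (t *: _ + _) _]BC B_lin.
  rewrite /GRing.scale/= (BC (y - u) u); ring.
move=> h1 h2; rewrite -(pmulr_rge0 _ t0) /GRing.scale/=; lra.
Qed.

End conjugate.

(** * The conjugate of a strongly convex function and its gradient *)

Section strongly_convex_conjugate.
Context {R : realType} {E : finDimNormedModType R}.
Variables (Q : set E) (phi : E -> R) (p : nat) (sigma : R).
Implicit Types s t : 'Hom(E, R^o).

Hypothesis Qcl : closed Q.
Hypothesis Qcvx : convex_set Q.
Hypothesis philsc : lower_semicontinuous (ext Q phi).
Hypothesis phicvx : convex_function Q phi.
Hypothesis Q0 : Q !=set0.
Hypothesis p2 : (2 <= p)%N.
Hypothesis sigma0 : 0 < sigma.
Hypothesis phistrong : strongly_convex Q phi p sigma.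

(** Strong convexity at one known subgradient [g] bounds [phi] below by a p-th power, which outgrows
    the linear term [s - g]; hence the supremum defining the conjugate at [s] is attained, at
    [v]. *)
Lemma conjugate_attained s :
  exists2 v, Q v & forall x, Q x -> phi v + s (x - v) <= phi x.
Proof.
have [u [g [Qu gu]]] := subdifferential_nonempty Qcl Qcvx philsc phicvx Q0.
pose c := sigma / p%:R.
have c0 : 0 < c by rewrite divr_gt0// ltr0n (leq_trans _ p2).
pose N := dual_norm (s - g).
have N0 : 0 <= N := dual_norm_ge0 _.
(* Chosen so that [c * L = N + 1]: the p-th power absorbs the slope [N] of [s - g] and leaves slope
   1. *)
pose L := (N + 1) / c.
have L0 : 0 <= L by rewrite divr_ge0 ?(ltW c0)// addr_ge0.
pose k := phi u - s u - c * (L * (1 + L)) - `|u|.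
have ms : continuous ((- s : 'Hom(E, R^o)) : E -> R^o).
  exact: functional_continuous.
have [x Qx|v Qv vmin] := @coercive_attains_min _ _ Q phi Qcl philsc _ k ms Q0.
  have := phistrong Qu Qx gu; rewrite -/c => h.
  have := ler_wpM2l (ltW c0) (expr_superlinear p2 L0 (normr_ge0 (x - u))).
  have : (s - g) (x - u) <= N * `|x - u| := le_dual_norm _ _.
  have : `|x| <= `|x - u| + `|u| by rewrite -{1}[x](subrK u) ler_normD.
  have -> : c * (L * `|x - u| - L * (1 + L)) =
    (N + 1) * `|x - u| - c * (L * (1 + L)).
    by rewrite /L; field; rewrite gt_eqF.
  move: h; rewrite !(add_lfunE, opp_lfunE) !linearB/= /k.
  lra.
exists v => // x Qx; have := vmin x Qx.
rewrite !opp_lfunE linearB/=; lra.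
Qed.

Lemma fine_conjugate s v : Q v ->
  (forall x, Q x -> phi v + s (x - v) <= phi x) ->
  fine (conjugate (ext Q phi) s) = s v - phi v.
Proof.
move=> Qv vmax; rewrite (_ : conjugate _ _ = (s v - phi v)%:E)//.
apply/eqP; rewrite eq_le; apply/andP; split.
  apply: ge_ereal_sup => _ [x _ <-]; have [Qx|Qx] := pselect (Q x).
    rewrite ext_in// -EFinB lee_fin.
    by have := vmax x Qx; rewrite linearB/=; lra.
  by rewrite ext_out//= leNye.
by apply: ereal_sup_ubound; exists v => //; rewrite ext_in.
Qed.

Lemma subgradient_strongly_convex s v : Q v ->
  (forall x, Q x -> phi v + s (x - v) <= phi x) ->
  forall x, Q x -> sigma / p%:R * `|x - v| ^+ p <= phi x - phi v - s (x - v).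
Proof.
by move=> Qv sv x Qx; apply: phistrong => //; apply/subdifferential_extP.
Qed.

(** Let [w] be the maximizer for [t], d = |w - v| and c = sigma / p. Optimality of [w] and strong
    convexity at [v] place the first-order error between 0 and |t - s| d - c d^p, with the dual norm
    on t - s. *)
Lemma is_dual_grad_conjugate s v : Q v ->
  (forall x, Q x -> phi v + s (x - v) <= phi x) ->
  is_dual_grad (fine \o conjugate (ext Q phi)) s v.
Proof.
move=> Qv vmax e e0; pose c := sigma / p%:R.
have c0 : 0 < c by rewrite divr_gt0// ltr0n (leq_trans _ p2).
exists (c * e ^+ p.-1) => [|t ts]; first by rewrite mulr_gt0// exprn_gt0.
have [w Qw wmax] := conjugate_attained t.
rewrite /= (fine_conjugate Qv vmax) (fine_conjugate Qw wmax).
have h1 := wmax v Qv; have h2 := subgradient_strongly_convex Qv vmax Qw.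
have h3 := le_dual_norm (t - s) (w - v).
set d := `|w - v| in h2 h3; rewrite -/c in h2.
have tsv : (t - s) v = t v - s v :> R by rewrite add_lfunE opp_lfunE.
have tsw : (t - s) (w - v) = t w - s w - (t v - s v) :> R.
  by rewrite linearB/= !(add_lfunE, opp_lfunE); ring.
rewrite tsv; rewrite tsw in h3.
have h1' : phi w + (t v - t w) <= phi v by move: h1; rewrite linearB.
have h2' : c * d ^+ p <= phi w - phi v - (s w - s v) by move: h2; rewrite linearB.
have d0 : 0 <= d := normr_ge0 _; have cp0 : 0 <= c * d ^+ p.
  by rewrite mulr_ge0 ?exprn_ge0// ltW.
rewrite ger0_norm; last by lra.
have T0 := dual_norm_ge0 (t - s).
have [de|de] := leP d e.
  have := ler_wpM2l T0 de; lra.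
(* If [d > e], the radius c e^(p-1) forces |t - s| d < c d^p, and the error would be negative. *)
exfalso.
have : c * e ^+ p.-1 <= c * d ^+ p.-1.
  by rewrite ler_pM2l// lerXn2r ?nnegrE// ltW.
have dp : 0 < d by lra.
move=> /(lt_le_trans ts); rewrite -(ltr_pM2r dp) -mulrA -exprSr.
rewrite prednK ?(leq_trans _ p2)//; lra.
Qed.

(** The maximizer is a dual gradient, hence by uniqueness the value selected by [get]. The descent
    argument knows [grad_conjugate] only through this property. *)
Lemma grad_conjugateP s :
  let v := grad_conjugate Q phi s in
  Q v /\ forall x, Q x -> sigma / p%:R * `|x - v| ^+ p <= phi x - phi v - s (x - v).
Proof.
have [v Qv vmax] := conjugate_attained s.
have gv := is_dual_grad_conjugate Qv vmax.
rewrite (_ : grad_conjugate Q phi s = v); last first.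
  by apply: (dual_grad_unique _ gv); apply: getPex; exists v.
split => //; exact: subgradient_strongly_convex.
Qed.

End strongly_convex_conjugate.

(** * The gradient inequality for convex functions *)

Section convex_gradient.
Context {R : realType} {E : finDimNormedModType R}.

Lemma convex_gradient_le (f : E -> R^o) (x y : E) :
  differentiable f x -> convex_function setT f -> grad f x (y - x) <= f y - f x.
Proof.
move=> df cf; rewrite /grad lfunE/=.
have dd : derivable f x (y - x) by apply: diff_derivable.
have := deriveE (y - x) df; set D := 'd f x _ => <-.
have cv : h^-1 *: ((f \o shift x) (h *: (y - x)) - f x) @[h --> 0^'+] --> 'D_(y - x) f x.
  exact: (cvg_dnbhs_at_right dd).
apply: (cvgr_to_le cv).
near=> h.
have h0 : 0 < h by near: h; exact: nbhs_right_gt.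
have h1 : h <= 1 by near: h; apply: nbhs_right_le.
have := convex_function_line cf (I : setT x) (I : setT y) (ltW h0) h1.
rewrite /= [h *: _ + x]addrC => H.
rewrite /GRing.scale/= ler_pdivrMl//; lra.
Unshelve. all: by end_near.
Qed.
End convex_gradient.

(** * Rising factorials compared with powers *)

Lemma rising_recl k n : rising k n.+1 = (k * rising k.+1 n)%N.
Proof.
rewrite /rising big_ord_recl addn0; congr (_ * _)%N.
by apply: eq_bigr => i _; rewrite lift0 addSnnS.
Qed.

Lemma rising_recr k n : rising k n.+1 = (rising k n * (k + n))%N.
Proof. by rewrite /rising big_ord_recr. Qed.

Lemma leq_exp_rising k n : (k ^ n <= rising k n)%N.
Proof.
rewrite -[n in (k ^ n)%N]card_ord -prod_nat_const.
by apply: leq_prod => i _; exact: leq_addr.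
Qed.

(** Every factor is below [k + n.+1]; for [n = p.-1] this base is the denominator [k + p] of the
    averaging step. *)
Lemma rising_leq_exp k n : (rising k.+1 n <= (k + n.+1) ^ n)%N.
Proof.
rewrite -[X in (_ ^ X)%N]card_ord -prod_nat_const.
by apply: leq_prod => i _; have := ltn_ord i; lia.
Qed.

(** * Young's inequality and the threshold on [C] *)

Section powR_lemmas.
Context {R : realType}.

Lemma powR_ratio (p : nat) (u : R) : (2 <= p)%N -> 0 <= u ->
  u `^ (p%:R / p.-1%:R) = u * u `^ p.-1%:R^-1.
Proof.
case: p => [//|n] /= n1 u0; have nR : 0 < n%:R :> R by rewrite ltr0n.
rewrite (_ : n.+1%:R / n%:R = 1 + n%:R^-1); last first.
  by rewrite -natr1; field; rewrite gt_eqF.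
rewrite powRD ?powRr1//; apply/implyP => /eqP h.
have : 0 < 1 + n%:R^-1 :> R by rewrite addr_gt0// invr_gt0.
by rewrite h ltxx.
Qed.

Lemma powR_expn_inv (n : nat) (u : R) : (0 < n)%N -> 0 <= u ->
  (u ^+ n) `^ n%:R^-1 = u.
Proof.
move=> n0 u0; rewrite -powR_mulrn// -powRrM mulfV ?powRr1//.
by rewrite pnatr_eq0 -lt0n.
Qed.

(** Young's inequality for [b / sigma] and [d] with exponents p/(p-1) and p, multiplied by
    [sigma]. *)
Lemma young_scaled (p : nat) (sigma b d : R) : (2 <= p)%N ->
  0 < sigma -> 0 <= b -> 0 <= d ->
  b * d - sigma / p%:R * d ^+ p <=
  p.-1%:R / p%:R * (b * (b / sigma) `^ p.-1%:R^-1).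
Proof.
move=> p2 sigma0 b0 d0.
have p0 : 0 < p%:R :> R by rewrite ltr0n (leq_trans _ p2).
have n0 : 0 < p.-1%:R :> R by rewrite ltr0n -subn1 subn_gt0.
have pn : p%:R = p.-1%:R + 1 :> R by rewrite natr1 prednK// (leq_trans _ p2).
have b'0 : 0 <= b / sigma by rewrite divr_ge0// ltW.
have := @conjugate_powR R (b / sigma) d (p%:R / p.-1%:R) p%:R b'0 d0.
rewrite divr_gt0// p0 => /(_ isT isT).
have -> : (p%:R / p.-1%:R)^-1 + p%:R^-1 = 1 :> R.
  by rewrite pn; field; rewrite !gt_eqF// -pn.
move=> /(_ erefl); rewrite powR_ratio// powR_mulrn//.
rewrite -(ler_pM2l sigma0).
set w := _ `^ _.
have -> : sigma * (b / sigma * d) = b * d by field; rewrite gt_eqF.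
have -> : sigma * (b / sigma * w / (p%:R / p.-1%:R) + d ^+ p / p%:R) =
  p.-1%:R / p%:R * (b * w) + sigma / p%:R * d ^+ p.
  by field; rewrite !gt_eqF.
by move=> h; rewrite lerBlDr.
Qed.

(* b d - (sigma / p) d^p is the increase of the Lyapunov function caused by
   the mirror step, and M s^(1/(p-1)) D^(p/(p-1)) its guaranteed decrease. *)
Lemma step_absorbed (p : nat) (sigma s M C theta rho K D d : R) :
  (2 <= p)%N -> 0 < sigma -> 0 < s -> 0 < M -> 0 < C -> 0 <= theta ->
  0 <= rho -> 0 <= K -> rho <= K ^+ p.-1 -> 0 <= D -> 0 <= d ->
  C <= theta * (sigma * M ^+ p.-1 / (p.-1%:R ^+ p.-1 * p%:R)) ->
  C * s * p%:R * rho * D * d - sigma / p%:R * d ^+ p <=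
  theta `^ p.-1%:R^-1 * (C * s * rho * K *
    (M * s `^ p.-1%:R^-1 * D `^ (p%:R / p.-1%:R))).
Proof.
move=> p2 sigma0 s0 M0 C0 th0 rho0 K0 rhoK D0 d0 hC.
have p0 : 0 < p%:R :> R by rewrite ltr0n (leq_trans _ p2).
have n0' : (0 < p.-1)%N by rewrite -subn1 subn_gt0.
have n0 : 0 < p.-1%:R :> R by rewrite ltr0n.
pose a := C * s * p%:R * rho.
have a0 : 0 <= a by rewrite !mulr_ge0// ltW.
apply: le_trans (young_scaled p2 sigma0 (mulr_ge0 a0 D0) d0) _.
rewrite (powR_ratio p2 D0) [a * D / sigma]mulrAC.
rewrite (@powRM _ (a / sigma)) ?divr_ge0 ?(ltW sigma0)//.
set q := p.-1%:R^-1.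
(* This remains once C s rho D^(p/(p-1)) is taken out of both sides. Its (p-1)-th power follows from
   [hC] and [rhoK], which is where the threshold on [C] comes from. *)
have key : p.-1%:R * (a / sigma) `^ q <= theta `^ q * (K * M * s `^ q).
  rewrite -{1}(powR_expn_inv n0' (ltW n0)) -{1}(powR_expn_inv n0' K0).
  rewrite -{1}(powR_expn_inv n0' (ltW M0)) -/q.
  have nn0 : 0 <= p.-1%:R ^+ p.-1 :> R by rewrite exprn_ge0// ltW.
  have M0' := ltW M0; have C0' := ltW C0; have s0' := ltW s0; have sigma0' := ltW sigma0.
  rewrite -!powRM ?mulr_ge0 ?exprn_ge0 ?invr_ge0//.
  apply: ge0_ler_powR; rewrite ?nnegrE ?invr_ge0 ?mulr_ge0 ?exprn_ge0 ?invr_ge0//.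
  have nn : 0 < p.-1%:R ^+ p.-1 :> R by rewrite exprn_gt0.
  rewrite mulrA in hC; rewrite ler_pdivlMr ?mulr_gt0// in hC.
  rewrite mulrA ler_pdivrMr//.
  have B0 : 0 <= theta * (sigma * M ^+ p.-1) by rewrite !mulr_ge0// exprn_ge0.
  have h1 := ler_wpM2r (mulr_ge0 s0' rho0) hC.
  have h2 := ler_wpM2l (mulr_ge0 B0 s0') rhoK.
  by move: h1 h2; rewrite /a; lra.
have D1 : 0 <= C * s * rho * (D * D `^ q).
  by rewrite !mulr_ge0 ?powR_ge0// ltW.
have := ler_wpM2l D1 key.
set T := (a / sigma) `^ q; set Dq := D `^ q; set sq := s `^ q; set tq := theta `^ q.
congr (_ <= _); last by ring.
by rewrite /a; field; rewrite gt_eqF.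
Qed.

End powR_lemmas.

(** * Decay of the running minimum *)

Section minimum_rate.
Context {R : realType}.

Lemma telescope_lower (u w : nat -> R) (b : R) m n :
  (forall k, u k.+1 + w k.+1 <= u k) ->
  (forall j, (m < j <= m + n)%N -> b <= w j) ->
  u (m + n)%N + n%:R * b <= u m.
Proof.
move=> Huw; elim: n => [_|n IH Hb]; first by rewrite addn0 mul0r addr0.
have {}IH := IH (fun j hj => Hb j ltac:(lia)).
have h1 := Huw (m + n)%N; have h2 := Hb (m + n).+1 ltac:(lia).
rewrite addnS -natr1; lra.
Qed.

(** Since [u] converges, its drop from k/2 to k tends to 0. That drop bounds a sum of at least k/2
    terms, each no less than c (k/2)^p times the minimum. The default [G 0] of the big minimum is
    one of its terms. *)
Lemma bigmin_littleo (p : nat) (c : R) (u G : nat -> R) : 0 < c ->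
  (forall k, 0 <= u k) -> (forall k, 0 <= G k) ->
  (forall k, u k.+1 + c * k.+1%:R ^+ p * G k.+1 <= u k) ->
  (fun k => \big[Num.min/G 0%N]_(i < k.+1) G i : R^o)
  =o_\oo (fun k => 1 / k%:R ^+ p.+1 : R^o).
Proof.
move=> c0 u0 G0 Hu.
have w0 k : 0 <= c * k.+1%:R ^+ p * G k.+1.
  by rewrite !mulr_ge0 ?exprn_ge0// ltW.
have udec : nonincreasing_seq u.
  by apply/nonincreasing_seqP => k; have := Hu k; have := w0 k; lra.
have ucv : u @ \oo --> inf (range u).
  by apply: nonincreasing_cvgn => //; exists 0 => _ [k _ <-].
have infu k : inf (range u) <= u k.
  by apply: ge_inf; [exists 0 => _ [? _ <-]|exists k].
apply/eqoP => e e0.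
(* The factor 2^(p+1) pays for k/2 occurring once as number of terms and p times in the weight. *)
pose delta := e * c / 2 ^+ p.+1.
have d0 : 0 < delta by rewrite divr_gt0 ?mulr_gt0.
have [n0 _ Hn0] : \forall n \near \oo, `|inf (range u) - u n| < delta.
  by move/cvgrPdist_lt : ucv; exact.
near=> k.
have k0 : (0 < k)%N by near: k; exists 1%N.
have kn0 : (n0.*2 <= k)%N by near: k; exists n0.*2.
set mk := \big[_/_]_(i < _) _.
have mk0 : 0 <= mk by apply/bigmin_geP.
have mkG j : (j <= k)%N -> mk <= G j.
  by move=> jk; apply: (bigmin_inf (inord j)) => //; rewrite inordK.
have kR : 0 < k%:R :> R by rewrite ltr0n.
have half : k%:R / 2 <= k./2.+1%:R :> R.
  by rewrite ler_pdivrMr// -natrM ler_nat; lia.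
have := @telescope_lower u (fun k => c * k%:R ^+ p * G k) (c * (k%:R / 2) ^+ p * mk)
  k./2 (k - k./2) Hu.
rewrite subnKC; last by lia.
have hb j : (k./2 < j <= k)%N -> c * (k%:R / 2) ^+ p * mk <= c * j%:R ^+ p * G j.
  move=> /andP[kj jk]; apply: ler_pM => //.
  - by rewrite mulr_ge0 ?exprn_ge0 ?divr_ge0// ltW.
  - rewrite ler_pM2l// lerXn2r ?nnegrE ?divr_ge0//.
    by rewrite (le_trans half)// ler_nat.
  - exact: mkG.
move=> /(_ hb) tel.
have := Hn0 k./2 ltac:(rewrite /=; lia); rewrite ltr_norml => /andP[un _].
have uk := infu k.
have halfk : k%:R / 2 <= (k - k./2)%:R :> R.
  by rewrite ler_pdivrMr// -natrM ler_nat; lia.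
have b0 : 0 <= c * (k%:R / 2) ^+ p * mk.
  by rewrite !mulr_ge0 ?exprn_ge0 ?divr_ge0// ltW.
have fin : k%:R / 2 * (c * (k%:R / 2) ^+ p * mk) <= delta.
  by have := ler_wpM2r b0 halfk; lra.
rewrite ger0_norm// ger0_norm; last by rewrite divr_ge0// exprn_ge0.
rewrite mulrA mulr1 ler_pdivlMr ?exprn_gt0//.
rewrite -(ler_pM2l c0) -(ler_pM2r (_ : 0 < (2 ^+ p.+1)^-1 :> R)) ?invr_gt0 ?exprn_gt0//.
apply: le_trans (le_trans fin _); last by rewrite /delta [c * e]mulrC.
rewrite exprS expr_div_n exprS le_eqVlt; apply/orP; left; apply/eqP.
by field; rewrite ?expf_neq0.
Unshelve. all: by end_near.
Qed.

End minimum_rate.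

(** * One step of the scheme and the Lyapunov function *)

Section accelerated_mirror_descent.
Context {R : realType} {E : finDimNormedModType R}.
Variables (p : nat) (f : E -> R^o) (Q : set E) (phi : E -> R).
Variables (sigma s M C : R) (xstar : E).
Variables (x y : nat -> E) (z : nat -> 'Hom(E, R^o)).
Hypothesis p2 : (2 <= p)%N.
Hypothesis f_diff : forall u, differentiable f u.
Hypothesis f_convex : convex_function setT f.
Hypothesis Q_closed : closed Q.
Hypothesis Q_convex : convex_set Q.
Hypothesis phi_lsc : lower_semicontinuous (ext Q phi).
Hypothesis phi_convex : convex_function Q phi.
Hypothesis sigma0 : 0 < sigma.
Hypothesis phi_strong : strongly_convex Q phi p sigma.
Hypothesis Qxstar : Q xstar.
Hypotheses (s0 : 0 < s) (M0 : 0 < M) (C0 : 0 < C).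
Hypothesis x_step : forall k, x k.+1 =
  (p%:R / (k + p)%:R) *: grad_conjugate Q phi (z k) + (k%:R / (k + p)%:R) *: y k.
Hypothesis z_step : forall k, z k.+1 =
  z k - (C * s * p%:R * (rising k.+1 p.-1)%:R) *: grad f (y k.+1).
Hypothesis y_descent : forall k, (1 <= k)%N ->
  M * s `^ (p.-1%:R^-1) * dual_norm (grad f (y k)) `^ (p%:R / p.-1%:R)
  <= grad f (y k) (x k - y k).

Let v k := grad_conjugate Q phi (z k).

Definition lyapunov k : R :=
  C * s * (rising k p)%:R * (f (y k) - f xstar)
  + (phi xstar - phi (v k) - z k (xstar - v k)).

Let v_subgrad k u : Q u ->
  sigma / p%:R * `|u - v k| ^+ p <= phi u - phi (v k) - z k (u - v k).
Proof.
by apply: (grad_conjugateP Q_closed Q_convex phi_lsc phi_convex _ p2 sigma0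
  phi_strong (z k)).2; exists xstar.
Qed.

Let Qv k : Q (v k).
Proof.
by apply: (grad_conjugateP Q_closed Q_convex phi_lsc phi_convex _ p2 sigma0
  phi_strong (z k)).1; exists xstar.
Qed.

Lemma bregman_ge0 k : 0 <= phi xstar - phi (v k) - z k (xstar - v k).
Proof.
apply: le_trans (v_subgrad k Qxstar).
by rewrite mulr_ge0 ?divr_ge0 ?exprn_ge0// ltW.
Qed.

(** [theta] is the share of the threshold that [C] may use: [theta = 1] gives monotonicity, while
    [theta < 1] leaves a positive fraction of the guaranteed decrease. *)
Lemma lyapunov_decrease (theta : R) k : 0 <= theta ->
  C <= theta * (sigma * M ^+ p.-1 / (p.-1%:R ^+ p.-1 * p%:R)) ->
  lyapunov k.+1 + (1 - theta `^ p.-1%:R^-1) *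
    (C * s * (rising k.+1 p)%:R * (M * s `^ p.-1%:R^-1 *
      dual_norm (grad f (y k.+1)) `^ (p%:R / p.-1%:R)))
  <= lyapunov k.
Proof.
move=> theta0 hC.
have p0 : 0 < p%:R :> R by rewrite ltr0n (leq_trans _ p2).
have pS : p = p.-1.+1 by rewrite prednK// (leq_trans _ p2).
set g := grad f (y k.+1); set rho : R := (rising k.+1 p.-1)%:R.
have rho0 : 0 <= rho by exact: ler0n.
pose K : R := (k + p)%:R.
have KE : K = k%:R + p%:R by rewrite /K natrD.
have K0 : 0 < K by rewrite KE ltr_wpDl.
have rhoK : rho <= K ^+ p.-1.
  by rewrite /rho /K -natrX ler_nat {2}pS rising_leq_exp.
(* Consecutive rising factorials share the factor [rho], with cofactors k + p and k: exactly the
   weights of the averaging step. *)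
have risK : (rising k.+1 p)%:R = rho * K.
  by rewrite {1}pS rising_recr natrM addSnnS -pS.
have risk : (rising k p)%:R = k%:R * rho by rewrite {1}pS rising_recl natrM.
have absorbed := step_absorbed p2 sigma0 s0 M0 C0 theta0 rho0 (ltW K0) rhoK
  (dual_norm_ge0 g) (normr_ge0 (v k.+1 - v k)) hC.
have desc : _ <= g (x k.+1 - y k.+1) := y_descent (ltn0Sn k).
rewrite -/g in desc.
set W := M * _ * _ in absorbed desc *.
have hx : K * g (x k.+1) = p%:R * g (v k) + k%:R * g (y k).
  have -> : g (x k.+1) = p%:R / K * g (v k) + k%:R / K * g (y k).
    by rewrite x_step linearD !linearZ.
  by field; rewrite -KE gt_eqF.
have conv1 : g (xstar - y k.+1) <= f xstar - f (y k.+1).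
  exact: convex_gradient_le.
have conv2 : g (y k - y k.+1) <= f (y k) - f (y k.+1).
  exact: convex_gradient_le.
have dual : g (v k - v k.+1) <= dual_norm g * `|v k.+1 - v k|.
  by rewrite distrC le_dual_norm.
have strong := v_subgrad k (Qv k.+1).
rewrite !linearB/= in desc conv1 conv2 dual strong.
have B0 : 0 <= C * s * rho by rewrite !mulr_ge0// ltW.
(* With weights C s rho times p, k, K and p, the f-terms add up to the Lyapunov difference since K =
   k + p, and by [hx] the values of [g] at x_{k+1}, v_k and y_k cancel. *)
have c1 := ler_wpM2l (mulr_ge0 B0 (ltW p0)) conv1.
have c2 := ler_wpM2l (mulr_ge0 B0 (ler0n R k)) conv2.
have c3 := ler_wpM2l (mulr_ge0 B0 (ltW K0)) desc.
have c4 := ler_wpM2l (mulr_ge0 B0 (ltW p0)) dual.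
have c5 : C * s * rho * (K * g (x k.+1)) =
   C * s * rho * (p%:R * g (v k) + k%:R * g (y k)) by rewrite hx.
rewrite /lyapunov risK risk !linearB/= z_step -/g -/rho.
rewrite !(add_lfunE, opp_lfunE, scale_lfunE) /GRing.scale/=.
move: absorbed strong c1 c2 c3 c4 c5; rewrite KE.
set T := theta `^ _; set Y := `|_| ^+ p; set d := `|_|; set D := dual_norm g.
lra.
Qed.

End accelerated_mirror_descent.

(** * Both rates from the Lyapunov decrease *)

Theorem theorem6 (R : realType) (E : finDimNormedModType R) (p : nat)
    (f : E -> R^o) (Q : set E) (phi : E -> R) (sigma s M C : R) (xstar : E)
    (x y : nat -> E) (z : nat -> 'Hom(E, R^o)) :
  (2 <= p)%N ->
  continuously_differentiable f ->
  convex_function setT f ->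
  closed Q ->
  convex_set Q ->
  lower_semicontinuous (ext Q phi) ->
  convex_function Q phi ->
  0 < sigma ->
  strongly_convex Q phi p sigma ->
  Q xstar ->
  (forall u, Q u -> f xstar <= f u) ->
  0 < s -> 0 < M -> 0 < C ->
  x 0%N = grad_conjugate Q phi (z 0%N) ->
  (forall k, Q (y k)) ->
  (forall k, x k.+1 = (p%:R / (k + p)%:R) *: grad_conjugate Q phi (z k)
                      + (k%:R / (k + p)%:R) *: y k) ->
  (forall k, z k.+1 = z k
     - (C * s * p%:R * (rising k.+1 p.-1)%:R) *: grad f (y k.+1)) ->
  (forall k, (1 <= k)%N ->
     M * s `^ (p.-1%:R^-1) * dual_norm (grad f (y k)) `^ (p%:R / p.-1%:R)
     <= grad f (y k) (x k - y k)) ->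
  (C <= sigma * M ^+ p.-1 / (p.-1%:R ^+ p.-1 * p%:R) ->
   forall k, (1 <= k)%N ->
     f (y k) - f xstar
     <= (phi xstar - phi (x 0%N) - z 0%N (xstar - x 0%N))
        / (C * s * (rising k p)%:R)) /\
  (C < sigma * M ^+ p.-1 / (p.-1%:R ^+ p.-1 * p%:R) ->
   (fun k => \big[Num.min/dual_norm (grad f (y 0%N)) `^ (p%:R / p.-1%:R)]_(i < k.+1)
               dual_norm (grad f (y i)) `^ (p%:R / p.-1%:R) : R^o)
   =o_\oo (fun k => 1 / k%:R ^+ p.+1 : R^o)).
Proof.
move=> p2 [f_diff _] f_cvx Q_cl Q_cvx phi_lsc phi_cvx sigma0 phi_strong Qxstar
  xmin s0 M0 C0 x0 Qy x_step z_step y_desc.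
have decr := lyapunov_decrease p2 f_diff f_cvx Q_cl Q_cvx phi_lsc phi_cvx sigma0
  phi_strong Qxstar s0 M0 C0 x_step z_step y_desc.
have breg := bregman_ge0 z p2 Q_cl Q_cvx phi_lsc phi_cvx sigma0 phi_strong Qxstar.
pose L := lyapunov p f Q phi s C xstar y z.
split=> [hC k k1|hC].
  (* With [theta = 1] the surplus has coefficient 0, leaving plain monotonicity. *)
  have Ldec j : L j <= L 0%N.
    elim: j => // j; apply: le_trans.
    have := decr 1 j ler01; rewrite mul1r powR1 subrr mul0r addr0; exact.
  have L0 : L 0%N = phi xstar - phi (x 0%N) - z 0%N (xstar - x 0%N).
    (* The rising factorial at 0 contains the factor 0, so no trace of f(y_0) is left in the initial
       value. *)
    rewrite /L /lyapunov -x0 (_ : rising 0 p = 0)%N ?mulr0 ?mul0r ?add0r//.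
    by case: (p) p2 => // n _; rewrite rising_recl.
  have ris0 : 0 < (rising k p)%:R :> R.
    by rewrite ltr0n (leq_trans _ (leq_exp_rising k p))// expn_gt0 k1.
  rewrite ler_pdivlMr ?mulr_gt0// -L0 (le_trans _ (Ldec k))// mulrC.
  by rewrite /L /lyapunov lerDl breg.
have p0 : 0 < p%:R :> R by rewrite ltr0n (leq_trans _ p2).
have n0 : 0 < p.-1%:R :> R by rewrite ltr0n -subn1 subn_gt0.
set Cmax := (X in C < X) in hC decr.
have Cmax0 : 0 < Cmax by exact: lt_trans hC.
(* Under the strict bound this ratio is below 1, so the surplus coefficient [a] is positive. *)
pose theta := C / Cmax.
have theta0 : 0 < theta by rewrite divr_gt0.
have thetaC : C <= theta * Cmax by rewrite /theta divfK// gt_eqF.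
pose a := 1 - theta `^ p.-1%:R^-1.
have a0 : 0 < a.
  have theta1 : theta < 1 by rewrite ltr_pdivrMr// mul1r.
  have q0 : 0 < p.-1%:R^-1 :> R by rewrite invr_gt0.
  have := gt0_ltr_powR q0 _ _ theta1.
  by rewrite powR1 !nnegrE ler01 (ltW theta0) subr_gt0; apply.
have sq0 : 0 < s `^ p.-1%:R^-1 by rewrite powR_gt0.
apply: (@bigmin_littleo _ p (a * (C * s * (M * s `^ p.-1%:R^-1))) L
  (fun k => dual_norm (grad f (y k)) `^ (p%:R / p.-1%:R))).
- by rewrite !mulr_gt0.
(* Minimality of [xstar] over [Q], applied to [y k], makes the f-part nonnegative. *)
- move=> k; rewrite addr_ge0 ?breg// !mulr_ge0 ?(ltW C0) ?(ltW s0)//.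
  by rewrite subr_ge0 xmin.
- by move=> k; exact: powR_ge0.
move=> k; apply: le_trans (decr theta k (ltW theta0) thetaC); rewrite lerD2l -/a.
set G := _ `^ (p%:R / _).
have -> : a * (C * s * (M * s `^ p.-1%:R^-1)) * k.+1%:R ^+ p * G =
  a * (C * s * (M * s `^ p.-1%:R^-1)) * G * k.+1%:R ^+ p by ring.
have -> : a * (C * s * (rising k.+1 p)%:R * (M * s `^ p.-1%:R^-1 * G)) =
  a * (C * s * (M * s `^ p.-1%:R^-1)) * G * (rising k.+1 p)%:R by ring.
(* The rising factorial at k + 1 dominates (k+1)^p, the weight required by [bigmin_littleo]. *)
rewrite ler_wpM2l//; first by rewrite !mulr_ge0 ?powR_ge0// ltW.
by rewrite -natrX ler_nat leq_exp_rising.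
Qed.
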